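(* Let $S$ be a set with at least $2$ elements, equipped with a betweenness relation $b$, let $\tilde{\mathbb{T}}_S$ be its (noncommutative) Dress group with generators $\tilde{T}_{s,t}$ ($s,t\in S$, $s\neq t$), and let $$\mathbb{G}_0 := \Big\{\sum_{s \in S} n_s \cdot \delta_s \in \mathbb{Z}^S_{fin} \ \Big|\ \sum_{s \in S} n_s = 0\Big\}.$$ Then there is a well-defined group homomorphism $\psi: \tilde{\mathbb{T}}_S \rightarrow \mathbb{G}_0$ given by $$\psi(\tilde{T}_{s,t}) := \delta_t - \delta_s \qquad (s,t\in S,\ s\neq t).$$ Moreover, $\psi$ is surjective. Hence, if $\mathbb{K}_0$ denotes the kernel of $\psi$, then $$\tilde{\mathbb{T}}_S / \mathbb{K}_0 \simeq \mathbb{G}_0 .$$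
   Context: A betweenness relation on a set $S$ is a three-point relation $b(p,q,r)$ on $S$ such that: (1) if $b(p,q,r)$ then $p,q,r$ are distinct; (2) if $b(p,q,r)$ then not $b(q,p,r)$; (3) if $b(p,q,r)$ and $b(p,r,s)$, then $b(p,q,s)$ and $b(q,r,s)$; (4) if $b(p,q,s)$ and $b(q,r,s)$, then $b(p,r,s)$ and $b(p,q,r)$. Symmetry ($b(p,q,r)\Rightarrow b(r,q,p)$) is not required. Dress group: let $\tilde{\mathbb{F}}_S$ be the free group generated by all symbols $X_{p,q}$ for $p,q\in S$ with $p\neq q$. Let $\tilde{\mathbb{K}}_S$ be the smallest normal subgroup of $\tilde{\mathbb{F}}_S$ containing all elements $X_{p,r}\cdot X_{q,r}^{-1}\cdot X_{p,q}^{-1}$ with $b(p,q,r)$. The (in general noncommutative) Dress group is $\tilde{\mathbb{T}}_S=\tilde{\mathbb{F}}_S/\tilde{\mathbb{K}}_S$, and $\tilde{T}_{p,q}$ denotes the image of $X_{p,q}$ in it. $\mathbb{Z}^S_{fin}$ is the additive group of all maps $f:S\to\mathbb{Z}$ of finite support (i.e. $f(s)\neq 0$ for only finitely many $s\in S$). For $s\in S$, $\delta_s$ is the map with $\delta_s(s)=1$ and $\delta_s(t)=0$ for $t\neq s$; the $\delta_s$ form a basis of the free $\mathbb{Z}$-module $\mathbb{Z}^S_{fin}$. *)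

(* Defs.v *)
From HB Require Import structures.
From mathcomp Require Import all_boot ssralg ssrint.
From mathcomp Require Import finmap boolp classical_sets.
From mathcomp.multinomials Require Import monalg.

Set Implicit Arguments.
Unset Strict Implicit.
Unset Printing Implicit Defensive.

Local Open Scope group_scope.
Local Open Scope classical_set_scope.

(* The elements are the reduced words in the letters (a, false), read as a,
   and (a, true), read as the inverse of a; the product is concatenation
   followed by free reduction. *)
Section FreeGroup.
Variable A : choiceType.
Implicit Types (l m : A * bool) (u v w : seq (A * bool)).

Definition inv_letter l : A * bool := (l.1, ~~ l.2).

Definition reduced_word w := sorted (fun l m => m != inv_letter l) w.

Definition push l w :=
  if w is m :: w' then if m == inv_letter l then w' else l :: w else [:: l].

Definition word_mul u v := foldr push v u.
Definition word_inv u := rev (map inv_letter u).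

Record free_group := FreeGroup {
  fg_word :> seq (A * bool);
  fg_wordP : reduced_word fg_word
}.

HB.instance Definition _ := [isSub for fg_word].
HB.instance Definition _ := [Choice of free_group by <:].

Lemma inv_letterK : involutive inv_letter.
Proof. by case=> a e; rewrite /inv_letter /= negbK. Qed.

Lemma reduced_push l w : reduced_word w -> reduced_word (push l w).
Proof.
case: w => [|m w] //= hw; case: ifPn => [_|hm]; first exact: path_sorted hw.
by rewrite /= hm.
Qed.

Lemma reduced_word_mul u v : reduced_word v -> reduced_word (word_mul u v).
Proof. by move=> hv; elim: u => //= l u; apply: reduced_push. Qed.

Lemma pushK l w : reduced_word w -> push (inv_letter l) (push l w) = w.
Proof.
case: w => [|m w] /=; first by rewrite inv_letterK eqxx.
case: (eqVneq m (inv_letter l)) => [->|hm] hw /=; last by rewrite inv_letterK eqxx.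
by case: w hw => [|k w] //= /andP[/negPf-> _].
Qed.

Lemma push_invK l w : reduced_word w -> push l (push (inv_letter l) w) = w.
Proof. by move=> hw; rewrite -{1}(inv_letterK l) pushK. Qed.

Lemma word_mul_push l u v :
  reduced_word v -> word_mul (push l u) v = push l (word_mul u v).
Proof.
move=> hv; case: u => [|m u] //=; case: eqVneq => [->|//].
by rewrite push_invK //; apply: reduced_word_mul.
Qed.

Lemma word_mulA u v w :
  reduced_word w -> word_mul u (word_mul v w) = word_mul (word_mul u v) w.
Proof. by move=> hw; elim: u => //= l u ->; rewrite word_mul_push. Qed.

Lemma word_mul0 u : reduced_word u -> word_mul u [::] = u.
Proof.
elim: u => //= l u IH hlu; rewrite IH; last exact: path_sorted hlu.
by case: u hlu {IH} => //= m u /andP[/negPf-> _].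
Qed.

Lemma word_invK : involutive word_inv.
Proof. by move=> u; rewrite /word_inv map_rev revK mapK //; exact: inv_letterK. Qed.

Lemma reduced_word_inv u : reduced_word u -> reduced_word (word_inv u).
Proof.
rewrite /reduced_word /word_inv rev_sorted sorted_map; apply: sub_sorted => l m.
by rewrite /= inv_letterK eq_sym.
Qed.

Lemma word_mulV u v : reduced_word v -> word_mul (word_inv u) (word_mul u v) = v.
Proof.
move=> hv; elim: u => //= l u IH.
rewrite /word_inv /= rev_cons /word_mul foldr_rcons.
by rewrite pushK; [exact: IH | exact: reduced_word_mul].
Qed.

Definition fg_one : free_group := @FreeGroup [::] isT.
Definition fg_mul (u v : free_group) : free_group :=
  FreeGroup (reduced_word_mul u (fg_wordP v)).
Definition fg_inv (u : free_group) : free_group :=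
  FreeGroup (reduced_word_inv (fg_wordP u)).
Definition fg_gen (a : A) : free_group := @FreeGroup [:: (a, false)] isT.

Fact fg_mulA : associative fg_mul.
Proof. by move=> u v w; apply/val_inj/word_mulA/fg_wordP. Qed.

Fact fg_mul1g : left_id fg_one fg_mul.
Proof. by move=> u; apply/val_inj. Qed.

Fact fg_mulg1 : right_id fg_one fg_mul.
Proof. by move=> u; apply/val_inj/word_mul0/fg_wordP. Qed.

Fact fg_mulVg : left_inverse fg_one fg_inv fg_mul.
Proof.
move=> u; apply/val_inj => /=.
by rewrite -[X in word_mul _ X]word_mul0 ?word_mulV ?fg_wordP.
Qed.

Fact fg_mulgV : right_inverse fg_one fg_inv fg_mul.
Proof.
move=> u; rewrite -{1}[u](_ : fg_inv (fg_inv u) = u) ?fg_mulVg //.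
by apply/val_inj/word_invK.
Qed.

HB.instance Definition _ :=
  isGroup.Build free_group fg_mulA fg_mul1g fg_mulg1 fg_mulVg fg_mulgV.

End FreeGroup.

Definition normal_subgroup (G : groupType) (N : G -> Prop) : Prop :=
  [/\ N 1,
      forall x y, N x -> N y -> N (x / y) &
      forall x y, N x -> N (x ^ y)].

Record normalSubgroup (G : groupType) := NormalSubgroup {
  ns_set :> G -> Prop;
  ns_normal : normal_subgroup ns_set
}.

Section QuotientGroup.
Variables (G : groupType) (N : normalSubgroup G).
Implicit Types x y : G.

Definition coset_rel x y : bool := `[< N (x^-1 * y) >].

Lemma ns1 : N 1. Proof. by case: (ns_normal N). Qed.

Lemma nsV x : N x -> N x^-1.
Proof. by case: (ns_normal N) => h1 hD _ hx; rewrite -[_^-1]mul1g; exact: hD. Qed.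

Lemma nsM x y : N x -> N y -> N (x * y).
Proof. by case: (ns_normal N) => _ hD _ hx hy; rewrite -[y]invgK; apply/hD/nsV. Qed.

Lemma nsJ x y : N x -> N (x ^ y).
Proof. by case: (ns_normal N) => _ _; apply. Qed.

Fact coset_rel_refl : reflexive coset_rel.
Proof. by move=> x; apply/asboolP; rewrite mulVg; exact: ns1. Qed.

Fact coset_rel_sym : symmetric coset_rel.
Proof.
by move=> x y; apply/asboolP/asboolP => /nsV; rewrite invgM invgK.
Qed.

Fact coset_rel_trans : transitive coset_rel.
Proof.
move=> y x z /asboolP hxy /asboolP hyz; apply/asboolP.
by have := nsM hxy hyz; rewrite -mulgA mulVKg.
Qed.

Canonical coset_equiv : equiv_rel G :=
  EquivRel coset_rel coset_rel_refl coset_rel_sym coset_rel_trans.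

Definition quotient_group := {eq_quot coset_equiv}%qT.

HB.instance Definition _ := Choice.on quotient_group.
HB.instance Definition _ := EqQuotient.on quotient_group.

Definition coset (x : G) : quotient_group := \pi_quotient_group%qT x.

Lemma coset_eqP x y : coset x = coset y <-> N (x^-1 * y).
Proof.
split=> [/eqmodP/asboolP // | h]; by apply/eqmodP/asboolP.
Qed.

Definition quotient_one : quotient_group := coset 1.
Definition quotient_mul (X Y : quotient_group) : quotient_group :=
  coset (repr X * repr Y).
Definition quotient_inv (X : quotient_group) : quotient_group :=
  coset (repr X)^-1.

Lemma repr_coset x : N (x^-1 * repr (coset x)).
Proof. by apply/coset_eqP; rewrite /coset reprK. Qed.

Lemma cosetM x y : coset (x * y) = quotient_mul (coset x) (coset y).
Proof.
apply/coset_eqP; set x' := repr (coset x); set y' := repr (coset y).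
have -> : (x * y)^-1 * (x' * y') = (x^-1 * x') ^ y * (y^-1 * y').
  by rewrite /conjg invgM !mulgA mulgK.
by apply: nsM; [apply: nsJ|]; exact: repr_coset.
Qed.

Lemma cosetV x : coset x^-1 = quotient_inv (coset x).
Proof.
apply/coset_eqP; set x' := repr (coset x).
have -> : x^-1^-1 * x'^-1 = ((x^-1 * x')^-1) ^ x^-1.
  by rewrite /conjg !invgM !invgK !mulgA mulgK.
by apply/nsJ/nsV/repr_coset.
Qed.

Lemma coset_surj (X : quotient_group) : exists x, X = coset x.
Proof. by exists (repr X); rewrite /coset reprK. Qed.

Fact quotient_mulA : associative quotient_mul.
Proof.
move=> X Y Z; have [[x ->] [y ->] [z ->]] := And3 (coset_surj X) (coset_surj Y) (coset_surj Z).
by rewrite -!cosetM mulgA.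
Qed.

Fact quotient_mul1g : left_id quotient_one quotient_mul.
Proof. by move=> X; have [x ->] := coset_surj X; rewrite -cosetM mul1g. Qed.

Fact quotient_mulg1 : right_id quotient_one quotient_mul.
Proof. by move=> X; have [x ->] := coset_surj X; rewrite -cosetM mulg1. Qed.

Fact quotient_mulVg : left_inverse quotient_one quotient_inv quotient_mul.
Proof. by move=> X; have [x ->] := coset_surj X; rewrite -cosetV -cosetM mulVg. Qed.

Fact quotient_mulgV : right_inverse quotient_one quotient_inv quotient_mul.
Proof. by move=> X; have [x ->] := coset_surj X; rewrite -cosetV -cosetM mulgV. Qed.

HB.instance Definition _ := isGroup.Build quotient_group
  quotient_mulA quotient_mul1g quotient_mulg1 quotient_mulVg quotient_mulgV.
HB.instance Definition _ := monoid.isMultiplicative.Build G quotient_group coset cosetM.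

End QuotientGroup.

Fact normal_closure_subproof (G : groupType) (A : set G) :
  normal_subgroup (smallest (@normal_subgroup G) A).
Proof.
split.
- by move=> N hN; have [h1 _ _] := hN.1; exact: h1.
- move=> x y hx hy N hN; have [_ hD _] := hN.1.
  exact: hD (hx _ hN) (hy _ hN).
- by move=> x y hx N hN; have [_ _ hJ] := hN.1; exact: hJ (hx _ hN).
Qed.

Definition normal_closure (G : groupType) (A : set G) : normalSubgroup G :=
  NormalSubgroup (normal_closure_subproof A).

Fact kernel_subproof (G H : groupType) (f : {multiplicative G -> H}) :
  normal_subgroup [set x : G | f x = 1].
Proof.
have f1 : f 1 = 1 by apply: (mulgI (f 1)); rewrite -gmulfM !mulg1.
have fV x : f x^-1 = (f x)^-1 by apply: (mulgI (f x)); rewrite -gmulfM !mulgV.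
split=> [//|x y /= hx hy|x y /= hx]; first by rewrite gmulfM fV hx hy mulgV.
by rewrite /conjg !gmulfM fV hx mul1g mulVg.
Qed.

Definition kernel (G H : groupType) (f : {multiplicative G -> H}) :
  normalSubgroup G := NormalSubgroup (kernel_subproof f).

Definition isomorphic (G H : groupType) : Prop :=
  exists f : {multiplicative G -> H}, bijective f.

Definition betweenness (S : Type) (b : S -> S -> S -> Prop) : Prop :=
  [/\ forall p q r, b p q r -> [/\ p <> q, q <> r & p <> r],
      forall p q r, b p q r -> ~ b q p r,
      forall p q r s, b p q r -> b p r s -> b p q s /\ b q r s &
      forall p q r s, b p q s -> b q r s -> b p r s /\ b p q r].

Section DressGroup.
Variables (S : choiceType) (b : S -> S -> S -> Prop).

Definition off_diagonal := {pq : S * S | pq.1 != pq.2}.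

Definition dress_free := free_group off_diagonal.
HB.instance Definition _ := monoid.Group.on dress_free.

Definition dress_X (p q : S) (pq : p != q) : dress_free :=
  fg_gen (exist (fun pq : S * S => pq.1 != pq.2) (p, q) pq).

Definition dress_relators : set dress_free :=
  [set w | exists p q r (pq : p != q) (qr : q != r) (pr : p != r),
     b p q r /\ w = dress_X pr * (dress_X qr)^-1 * (dress_X pq)^-1].

Definition dress_group := quotient_group (normal_closure dress_relators).
HB.instance Definition _ := monoid.Group.on dress_group.

Definition dress_T (p q : S) (pq : p != q) : dress_group :=
  coset (normal_closure dress_relators) (dress_X pq).

End DressGroup.

(* {malg int[S]} is the additive group of the finitely supported maps S -> int,
   and << s >> is the map equal to 1 at s and to 0 elsewhere. *)
Section SumZero.
Local Open Scope ring_scope.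
Variable S : choiceType.
Implicit Types g h : {malg int[S]}.

Definition malg_sum g : int := \sum_(s <- msupp g) g@_s.

Definition sum_zero : {pred {malg int[S]}} := [pred g | malg_sum g == 0].

Lemma malg_sumEw (d : {fset S}%fset) g :
  (msupp g `<=` d)%fset -> malg_sum g = \sum_(s <- d) g@_s.
Proof.
move=> hgd; rewrite /malg_sum (big_fset_incl _ hgd) // => s _.
by rewrite -mcoeff_eq0 => /eqP.
Qed.

Lemma malg_sumB g h : malg_sum (g - h) = malg_sum g - malg_sum h.
Proof.
pose d := (msupp g `|` msupp h `|` msupp (g - h))%fset.
have hg : (msupp g `<=` d)%fset by rewrite /d -finmap.fsetUA finmap.fsubsetUl.
have hh : (msupp h `<=` d)%fset
  by rewrite /d (finmap.fsetUC (msupp g)) -finmap.fsetUA finmap.fsubsetUl.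
have hB : (msupp (g - h) `<=` d)%fset by rewrite /d finmap.fsubsetUr.
rewrite (malg_sumEw hg) (malg_sumEw hh) (malg_sumEw hB) -GRing.sumrB.
by apply: eq_bigr => s _; rewrite mcoeffB.
Qed.

Fact sum_zero_zmod_closed : zmod_closed sum_zero.
Proof.
split=> [|g h]; rewrite !inE; last by rewrite malg_sumB => /eqP-> /eqP->.
by rewrite -(GRing.subrr (0 : {malg int[S]})) malg_sumB GRing.subrr.
Qed.

HB.instance Definition _ :=
  GRing.isZmodClosed.Build {malg int[S]} sum_zero sum_zero_zmod_closed.

Record G0 := MkG0 { G0_val :> {malg int[S]}; _ : G0_val \in sum_zero }.

HB.instance Definition _ := [isSub for G0_val].
HB.instance Definition _ := [Choice of G0 by <:].
HB.instance Definition _ := [SubChoice_isSubZmodule of G0 by <:].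

End SumZero.

(* Main.v *)
Require Import Defs.
From HB Require Import structures.
From mathcomp Require Import all_boot ssralg ssrint.
From mathcomp Require Import finmap boolp classical_sets.
From mathcomp.multinomials Require Import monalg.

(** The homomorphism psi comes from two universal properties. A map from the
    letters to a group H extends to the free group by evaluating words
    ([fg_lift]), and a homomorphism that is trivial on a set of relators
    factors through the quotient by their normal closure
    ([factor_through_quotient], [normal_closure_sub]). Sending X_{p,q} to
    delta_q - delta_p kills every relator of the Dress group by telescoping:
    (delta_r - delta_p) - (delta_r - delta_q) - (delta_q - delta_p) = 0.
    Uniqueness holds because the letters generate ([fg_hom_ext]).

    For surjectivity, fix a base point s0. If the integers n_s sum to zero, then
    sum_s n_s delta_s = sum_s n_s (delta_s - delta_s0), so that the differences
    delta_s - delta_s0 generate G0 ([G0_generated]). Those with s <> s0 are the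
    values of psi at the generators T_{s0,s}, the remaining one is 0, and the
    image of psi is a subgroup. The last claim is then the first isomorphism
    theorem ([first_isomorphism]). *)

Set Implicit Arguments.
Unset Strict Implicit.
Unset Printing Implicit Defensive.

Section MultiplicativeMaps.
Local Open Scope group_scope.
Variables (G H : groupType) (phi : {multiplicative G -> H}).

(** Between groups, compatibility with products alone gives compatibility with
    the unit, and hence with inverses. *)
Lemma multiplicative1 : phi 1 = 1.
Proof. by apply: (mulgI (phi 1)); rewrite -gmulfM !mulg1. Qed.

Lemma multiplicativeV x : phi x^-1 = (phi x)^-1.
Proof.
by apply: (mulgI (phi x)); rewrite -gmulfM !mulgV multiplicative1.
Qed.

End MultiplicativeMaps.

Section FreeGroupUniversal.
Local Open Scope group_scope.
Variables (A : choiceType) (H : groupType).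

Section Lift.
Variable f : A -> H.

Definition letter_val (l : A * bool) : H := if l.2 then (f l.1)^-1 else f l.1.

Definition word_val (w : seq (A * bool)) : H :=
  foldr (fun l x => letter_val l * x) 1 w.

Lemma letter_val_inv l : letter_val (inv_letter l) = (letter_val l)^-1.
Proof. by case: l => a [] //=; rewrite /letter_val /= invgK. Qed.

Lemma word_val_push l w : word_val (push l w) = letter_val l * word_val w.
Proof.
case: w => [|m w] //=; case: eqP => [->|//] /=.
by rewrite letter_val_inv mulVKg.
Qed.

Lemma word_val_mul u v : word_val (word_mul u v) = word_val u * word_val v.
Proof.
by elim: u => [|l u IH] /=; rewrite ?mul1g // word_val_push IH mulgA.
Qed.

Definition fg_lift (u : free_group A) : H := word_val u.

Fact fg_liftM : {morph fg_lift : u v / u * v}.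
Proof. by move=> u v; apply: word_val_mul. Qed.

HB.instance Definition _ :=
  monoid.isMultiplicative.Build (free_group A) H fg_lift fg_liftM.

Lemma fg_lift_gen a : fg_lift (fg_gen a) = f a.
Proof. exact: mulg1. Qed.

End Lift.

Lemma fg_gen_inv (a : A) : (fg_gen a)^-1 = @FreeGroup A [:: (a, true)] isT.
Proof. exact/val_inj. Qed.

(** The letters generate the free group: a reduced word l :: w is the product
    of l and w, because no cancellation can take place between them. *)
Lemma fg_hom_ext (phi phi' : {multiplicative free_group A -> H}) :
  (forall a, phi (fg_gen a) = phi' (fg_gen a)) -> phi =1 phi'.
Proof.
move=> eq_gen [w]; elim: w => [|[a e] w IH] red_aw.
  have -> : FreeGroup red_aw = 1 :> free_group A by apply/val_inj.
  by rewrite !multiplicative1.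
have red_w : reduced_word w by apply: path_sorted red_aw.
have -> : FreeGroup red_aw =
    (if e then (fg_gen a)^-1 else fg_gen a) * FreeGroup red_w :> free_group A.
  apply/val_inj; rewrite fun_if fg_gen_inv.
  by case: e w red_aw red_w {IH} => [] [|m w] //= /andP[/negPf-> _].
by rewrite !gmulfM IH; case: e {red_aw}; rewrite ?multiplicativeV eq_gen.
Qed.

End FreeGroupUniversal.

Section Quotients.
Local Open Scope group_scope.
Variables G H : groupType.
Implicit Types (N : normalSubgroup G) (phi : {multiplicative G -> H}).

Lemma normal_closure_sub (A : set G) N :
  (forall x, A x -> N x) -> forall x, normal_closure A x -> N x.
Proof. by move=> sAN x; apply; split=> //; apply: ns_normal. Qed.

(** The induced map is phi evaluated at a chosen representative; a different
    representative changes x by an element of N, where phi is trivial. *)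
Lemma factor_through_quotient N phi : (forall x, N x -> phi x = 1) ->
  exists phi' : {multiplicative quotient_group N -> H},
    forall x, phi' (coset N x) = phi x.
Proof.
move=> phiN1; pose f (X : quotient_group N) := phi (repr X).
have f_coset x : f (coset N x) = phi x.
  have := phiN1 _ (repr_coset N x); rewrite gmulfM multiplicativeV => eq1.
  by apply: (mulgI (phi x)^-1); rewrite mulVg.
have fM : {morph f : X Y / X * Y}.
  move=> X Y; have [[x ->] [y ->]] := (coset_surj X, coset_surj Y).
  by rewrite -gmulfM !f_coset gmulfM.
pose f_mul := monoid.isMultiplicative.Build _ _ f fM.
by exists (HB.pack_for {multiplicative quotient_group N -> H} f f_mul).
Qed.

Lemma first_isomorphism phi :
  (forall y, exists x, phi x = y) -> isomorphic (quotient_group (kernel phi)) H.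
Proof.
move=> phi_surj; have [//|phi' phi'E] := @factor_through_quotient (kernel phi) phi.
have phi'_surj y : exists X, phi' X == y.
  by have [x <-] := phi_surj y; exists (coset (kernel phi) x); rewrite phi'E.
have phi'_inj : injective phi'.
  move=> X Y; have [[x ->] [y ->]] := (coset_surj X, coset_surj Y).
  rewrite !phi'E => eq_phi; apply/coset_eqP.
  by rewrite /= gmulfM multiplicativeV eq_phi mulVg.
have phi'K : cancel (fun y => xchoose (phi'_surj y)) phi'.
  by move=> y; apply/eqP/(xchooseP (phi'_surj y)).
by exists phi', (fun y => xchoose (phi'_surj y)) => // X; apply/phi'_inj/phi'K.
Qed.

End Quotients.

Section SumZeroGenerators.
Local Open Scope ring_scope.
Variable S : choiceType.
Implicit Types s t : S.

Lemma malg_sumU s : malg_sum (<< s >> : {malg int[S]}) = 1.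
Proof. by rewrite (malg_sumEw msuppU_le) big_seq_fset1 mcoeffUU. Qed.

Fact delta_diff_subproof s t : << t >> - << s >> \in @sum_zero S.
Proof. by rewrite inE malg_sumB !malg_sumU GRing.subrr. Qed.

Definition delta_diff s t : G0 S := MkG0 (delta_diff_subproof s t).

Lemma malgU_int (n : int) s : << n *g s >> = << s >> *~ n :> {malg int[S]}.
Proof.
apply/malgP => t; rewrite raddfMz /= !mcoeffU.
by case: eqP; rewrite ?GRing.mulr0n ?mul0rz // intz.
Qed.

(** As the coefficients of g sum to zero, subtracting delta_s0 from each basis
    vector in g = sum_s g_s delta_s does not change the sum. *)
Lemma G0_generated s0 (P : zmodClosed (G0 S)) :
  (forall s, delta_diff s0 s \in P) -> forall g, g \in P.
Proof.
move=> Pdelta g.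
suff -> : g = \sum_(s <- msupp (G0_val g)) delta_diff s0 s *~ (G0_val g)@_s.
  by apply: GRing.rpred_sum => s _; apply: rpredMz.
apply: val_inj; rewrite GRing.raddf_sum /=.
rewrite (eq_bigr (fun s => << (G0_val g)@_s *g s >> - << s0 >> *~ (G0_val g)@_s)).
  rewrite GRing.sumrB -monalgE -mulrz_sumr.
  by have /eqP := valP g; rewrite /malg_sum => ->; rewrite GRing.subr0.
move=> s _; rewrite malgU_int -mulrzBl.
exact: (raddfMz (val : {additive G0 S -> {malg int[S]}})).
Qed.

End SumZeroGenerators.

Section DressHomomorphism.
Variables (S : choiceType) (b : S -> S -> S -> Prop).

Lemma dress_hom_ext (H : groupType) (phi phi' : {multiplicative dress_group b -> H}) :
  (forall s t (st : s != t), phi (dress_T b st) = phi' (dress_T b st)) ->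
  phi =1 phi'.
Proof.
move=> eq_T X; have [x ->] := coset_surj X.
pose pi : {multiplicative dress_free S -> dress_group b} :=
  coset (normal_closure (dress_relators b)).
have := @fg_hom_ext (off_diagonal S) H (phi \o pi) (phi' \o pi).
by apply => -[[s t] st]; apply: (eq_T s t st).
Qed.

Lemma dress_hom_exists (H : groupType) (f : S -> S -> H) :
  (forall p q r, b p q r -> f p r * (f q r)^-1 * (f p q)^-1 = 1)%g ->
  exists phi : {multiplicative dress_group b -> H},
    forall s t (st : s != t), phi (dress_T b st) = f s t.
Proof.
move=> f_rel.
pose phi0 : {multiplicative dress_free S -> H} :=
  fg_lift (fun pq : off_diagonal S => f (val pq).1 (val pq).2).
have phi0X s t (st : s != t) : phi0 (dress_X st) = f s t by apply: fg_lift_gen.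
have [x|phi phiE] := @factor_through_quotient _ _
    (normal_closure (dress_relators b)) phi0.
  apply: (normal_closure_sub (N := kernel phi0)).
  move=> _ [p [q [r [pq [qr [pr [bpqr ->]]]]]]] /=.
  by rewrite !gmulfM !multiplicativeV !phi0X f_rel.
by exists phi => s t st; rewrite phiE phi0X.
Qed.

Local Open Scope ring_scope.
Variable psi : {multiplicative dress_group b -> Algebra.to_multiplicative (G0 S)}.

Definition hom_image : {pred G0 S} := [pred g | `[< exists x, psi x = g >]].

Fact hom_image_zmod_closed : GRing.zmod_closed hom_image.
Proof.
split=> [|g h /asboolP[x <-] /asboolP[y <-]]; apply/asboolP.
  by exists 1%g; apply: multiplicative1.
by exists (x / y)%g; rewrite gmulfM multiplicativeV.
Qed.

HB.instance Definition _ :=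
  GRing.isZmodClosed.Build (G0 S) hom_image hom_image_zmod_closed.

Lemma dress_hom_surj (s0 : S) :
  (forall s t (st : s != t), psi (dress_T b st) = delta_diff s t) ->
  forall g, exists x, psi x = g.
Proof.
move=> psiT g; apply/asboolP; rewrite -[asbool _]/(g \in hom_image).
apply: (G0_generated (s0 := s0)) => s; have [<-|s0s] := eqVneq s0 s.
  (* The base point has no generator T_{s0,s0}, but its difference is 0. *)
  have -> : delta_diff s0 s0 = 0 by apply: val_inj; rewrite /= GRing.subrr.
  exact: GRing.rpred0.
by apply/asboolP; exists (dress_T b s0s); apply: psiT.
Qed.

End DressHomomorphism.

Theorem proposition4p3 (S : choiceType) (b : S -> S -> S -> Prop)
    (hS : exists s t : S, s <> t) (hb : betweenness b) :
  exists psi : {multiplicative dress_group b -> Algebra.to_multiplicative (G0 S)},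
    [/\ forall (s t : S) (st : s != t),
          G0_val (psi (dress_T b st)) = (<< t >> - << s >>)%R,
        forall psi' : {multiplicative dress_group b -> Algebra.to_multiplicative (G0 S)},
          (forall (s t : S) (st : s != t),
             G0_val (psi' (dress_T b st)) = (<< t >> - << s >>)%R) ->
          psi' =1 psi,
        forall g : G0 S, exists x : dress_group b, psi x = g
      & isomorphic (quotient_group (kernel psi)) (Algebra.to_multiplicative (G0 S))].
Proof.
have [s0 _] := hS.
pose f s t : Algebra.to_multiplicative (G0 S) := delta_diff s t.
have [p q r _|psi psiT] := @dress_hom_exists S b _ f.
  apply: val_inj => /=.
  (* The product of to_multiplicative is the sum, so the relator telescopes. *)
  change (<< r >> - << p >> - (<< r >> - << q >>) - (<< q >> - << p >>) = 0 :> {malg int[S]})%R.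
  by rewrite !GRing.opprB [X in (X + _)%R]GRing.addrC
     !GRing.addrA !GRing.subrK GRing.subrr.
have psi_surj := dress_hom_surj s0 psiT.
exists psi; split=> // [s t st|psi' psi'T|].
- by rewrite psiT.
- by apply: dress_hom_ext => s t st; apply: val_inj; rewrite /= psi'T psiT.
- exact: first_isomorphism.
Qed.
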